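(* Let $h>0$ and let $v=(v_{i,j})_{i\in\mathbb{Z},\,j\in\mathbb{N}^\ast}\in \ell_h^2$ have compact support (i.e. only finitely many entries are non-zero). Then $$-\langle \Delta^{(1)}_h v, v \rangle_{\ell_h^2} \;\geq\; \frac{1}{4}\, \|v\|_{\ell_h^2}^2 .$$ Moreover, the constant $\frac14$ is sharp, meaning that it cannot be improved (i.e. replaced by a larger constant valid for all compactly supported $v\in\ell_h^2$).
   Context: $\mathbb{N}^\ast=\{1,2,3,\dots\}$; sequences are real-valued. The space of grid functions is $$\ell_h^2=\Big\{(v_{i,j})_{i\in\mathbb{Z},\,j\in\mathbb{N}^\ast}:\ \|v\|_{\ell_h^2}=\langle v,v\rangle_{\ell_h^2}^{1/2}<\infty\Big\},\qquad \langle u,v\rangle_{\ell_h^2}=\sum_{i\in\mathbb{Z},\,j\in\mathbb{N}^\ast}\frac{1}{j^2-\frac14}\,u_{i,j}v_{i,j}.$$ The first discrete Laplacian (on the hyperbolic plane) is $$(\Delta^{(1)}_h v)_{i,j}=\Big(j^2-\tfrac14\Big)\big(v_{i+1,j}+v_{i-1,j}+v_{i,j+1}+v_{i,j-1}-4v_{i,j}\big),\quad i\in\mathbb{Z},\ j\in\mathbb{N}^\ast,$$ with the convention $v_{i,0}=0$ for all $i\in\mathbb{Z}$. *)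

(* Defs.v *)
From mathcomp Require Import all_boot all_order all_algebra.
From mathcomp Require Import all_classical all_reals all_analysis.

Set Implicit Arguments.
Unset Strict Implicit.
Unset Printing Implicit Defensive.

Import Order.TTheory GRing.Theory Num.Theory.

Local Open Scope classical_set_scope.
Local Open Scope ring_scope.

Definition nstar := {j : nat | (0 < j)%N}.

Definition grid_fun (R : Type) := int -> nstar -> R.

(* The convention v_{i,0} = 0: extension of v by zero to the row j = 0. *)
Definition zero_ext (R : realType) (v : grid_fun R) (i : int) (j : nat) : R :=
  if insub j is Some j' then v i j' else 0.

Definition hyp_coef (R : realType) (j : nstar) : R := (val j)%:R ^+ 2 - 4^-1.

(* [esum] is meaningful for nonnegative terms only, so an (absolutely
   convergent) real sum over an arbitrary index type is the difference of the
   sums of the positive and of the negative parts. *)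
Definition rsum (R : realType) (I : choiceType) (f : I -> R) : R :=
  fine ((\esum_(x in setT) (fun y => (f y)%:E)^\+ x) -
        (\esum_(x in setT) (fun y => (f y)%:E)^\- x))%E.

Definition inner_h (R : realType) (u v : grid_fun R) : R :=
  rsum (fun p : int * nstar =>
    (hyp_coef R p.2)^-1 * (u p.1 p.2 * v p.1 p.2)).

Definition norm_h (R : realType) (v : grid_fun R) : R :=
  Num.sqrt (inner_h v v).

(* Stated in [\bar R]: [norm_h] is real-valued, and is 0 by convention when
   the series of squares diverges. *)
Definition in_l2h (R : realType) (v : grid_fun R) : Prop :=
  (\esum_(p in [set: int * nstar])
     ((hyp_coef R p.2)^-1 * (v p.1 p.2 * v p.1 p.2))%:E < +oo)%E.

Definition compact_support (R : realType) (v : grid_fun R) : Prop :=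
  finite_set [set p : int * nstar | v p.1 p.2 != 0].

Definition lap1 (R : realType) (v : grid_fun R) : grid_fun R := fun i j =>
  hyp_coef R j *
  (zero_ext v (i + 1) (val j) + zero_ext v (i - 1) (val j)
   + zero_ext v i (val j).+1 + zero_ext v i (val j).-1
   - 4 * zero_ext v i (val j)).

(* Main.v *)
Require Import Defs.
From mathcomp Require Import all_boot all_order all_algebra.
From mathcomp Require Import all_classical all_reals all_analysis.
From mathcomp Require Import ring lra zify.

Set Implicit Arguments.
Unset Strict Implicit.
Unset Printing Implicit Defensive.

Import Order.TTheory GRing.Theory Num.Theory.
Local Open Scope ring_scope.

(** The weight of the inner product cancels the coefficient of the Laplacian,
    so [- <Delta v, v>] is the Dirichlet form of the flat half-plane grid.
    Dropping the horizontal differences, the inequality reduces, column by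
    column, to a Hardy inequality with weight [1 / (4 j^2 - 1)]. The latter is
    the ground state argument for [phi_(j+1) / phi_j = (2 j + 1) / (2 j)]: the
    boundary term [x_j^2 / (2 j - 1)] telescopes and the remainder is a sum of
    squares.

    For sharpness, multiply [phi] by the cutoff
    [g_j = min (1, max (0, H_N - H_j))], with [H] the harmonic numbers. The
    energy in excess of the critical Hardy term is bounded uniformly in [N],
    whereas [sum_j g_j^2 / j] is unbounded, so a constant above [1 / 4] fails in
    one dimension. Repeating this column over [L] consecutive abscissas costs a
    horizontal energy independent of [L], negligible as [L] grows. *)

(** * Summation by parts and the Hardy inequality in one dimension *)

Lemma sum_by_parts (R : comPzRingType) (x : nat -> R) n :
  x 0%N = 0 -> x n.+1 = 0 ->
  \sum_(j < n) x j.+1 * (2 * x j.+1 - x j.+2 - x j) =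
  \sum_(j < n.+1) (x j.+1 - x j) ^+ 2.
Proof.
move=> x0 xn.
(* Keeping the boundary term [x n * (x n - x n.+1)] frees the induction from the condition at the
   right end. *)
suff -> : \sum_(j < n) x j.+1 * (2 * x j.+1 - x j.+2 - x j) =
    \sum_(j < n) (x j.+1 - x j) ^+ 2 + x n * (x n - x n.+1).
  by rewrite big_ord_recr /= xn; ring.
elim: n {xn} => [|n IH]; first by rewrite !big_ord0 x0; ring.
by rewrite !big_ord_recr /= IH; ring.
Qed.

Lemma natr_doubleS (R : pzSemiRingType) n : n.*2.+1%:R = 2 * n%:R + 1 :> R.
Proof. by rewrite -addn1 natrD -mul2n natrM. Qed.

Lemma discrete_hardy (R : realFieldType) (x : nat -> R) n : x 0%N = 0 ->
  \sum_(j < n) x j.+1 ^+ 2 / (4 * j.+1%:R ^+ 2 - 1) + x n.+1 ^+ 2 / n.*2.+1%:R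
  <= \sum_(j < n.+1) (x j.+1 - x j) ^+ 2.
Proof.
move=> x0; elim: n => [|n IH].
  by rewrite big_ord0 big_ord1 x0 subr0 add0r invr1 mulr1.
rewrite big_ord_recr [leRHS]big_ord_recr /=.
(* Given the induction hypothesis, the new squared difference only has to pay for the new Hardy term
   and the change of boundary term. *)
suff : x n.+1 ^+ 2 / (4 * n.+1%:R ^+ 2 - 1) + x n.+2 ^+ 2 / n.+1.*2.+1%:R
  <= (x n.+2 - x n.+1) ^+ 2 + x n.+1 ^+ 2 / n.*2.+1%:R.
  move=> H; rewrite -addrA; apply: le_trans (lerD (lexx _) H) _.
  by rewrite addrCA [leRHS]addrC lerD2l.
move: (x n.+1) (x n.+2) => a b.
have -> : n.*2.+1%:R = 2 * n.+1%:R - 1 :> R.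
  by rewrite natr_doubleS -[n.+1%:R]natr1; ring.
rewrite natr_doubleS.
have : 1 <= n.+1%:R :> R by rewrite ler1n.
move: (n.+1%:R) => j j1.
rewrite -subr_ge0.
(* Completed square: it vanishes along the ground state, where [b = (2 * j + 1) / (2 * j) * a]. *)
have -> : (b - a) ^+ 2 + a ^+ 2 / (2 * j - 1) -
    (a ^+ 2 / (4 * j ^+ 2 - 1) + b ^+ 2 / (2 * j + 1)) =
  2 * j / (2 * j + 1) * (b - (2 * j + 1) / (2 * j) * a) ^+ 2 +
  a ^+ 2 / (2 * j * (2 * j - 1) * (2 * j + 1)).
  by field; apply/and4P; split; apply/eqP; nra.
have jm : 0 <= 2 * j - 1 by lra.
have j2 : 0 <= 2 * j by lra.
have jp : 0 <= 2 * j + 1 by lra.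
apply: addr_ge0; last by rewrite divr_ge0 ?sqr_ge0// !mulr_ge0//; lra.
by rewrite mulr_ge0 ?sqr_ge0// divr_ge0.
Qed.

(** * Near-extremal sequences for the Hardy inequality *)

(* The hypotheses on [p], [x], [y] are those met by the ground state
   [p = phi_j] and two successive values of the logarithmic cutoff. *)
Lemma near_extremal_step (R : realFieldType) (d j p x y : R) :
  0 <= d -> 1 <= j -> j <= p ^+ 2 -> p ^+ 2 <= 2 * j - 1 ->
  0 <= x <= 1 -> 0 <= x - y -> x - y <= j^-1 ->
  (p * ((2 * j + 1) / (2 * j)) * y - p * x) ^+ 2 + d / 4 * (x ^+ 2 / j) +
    (p * x) ^+ 2 / (2 * j - 1) <=
  (1 + d) * ((p * x) ^+ 2 / (4 * j ^+ 2 - 1)) +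
    (p * ((2 * j + 1) / (2 * j)) * y) ^+ 2 / (2 * j + 1) +
    2 * (x - y) + (2^-1 * j^-1 - 2^-1 * (j + 1)^-1).
Proof.
move=> d0 j1 pl pu /andP[x0 x1] xy0 xyj.
have j0 : 0 < j by lra.
have jm : 0 < 2 * j - 1 by lra.
have jp : 0 < 2 * j + 1 by lra.
have jj : 0 < 4 * j ^+ 2 - 1 by nra.
(* Cost of the cutoff: one factor [x - y] is at most [j^-1], which absorbs the linear growth of
   [p ^+ 2]. *)
have H1 : p ^+ 2 * ((2 * j + 1) / (2 * j)) * (x - y) ^+ 2 <= 2 * (x - y).
  apply: (@le_trans _ _ ((2 * j - 1) * ((2 * j + 1) / (2 * j)) * ((x - y) * j^-1))).
    rewrite expr2; apply: ler_pM => //.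
    - by rewrite mulr_ge0 ?sqr_ge0// divr_ge0//; lra.
    - by rewrite mulr_ge0.
    - by rewrite ler_wpM2r// divr_ge0//; lra.
    - by rewrite ler_wpM2l.
  have -> : (2 * j - 1) * ((2 * j + 1) / (2 * j)) * ((x - y) * j^-1) =
      2 * (x - y) - (x - y) * (2 * j ^+ 2)^-1.
    by field; apply/eqP; lra.
  by rewrite lerBlDr lerDl mulr_ge0// invr_ge0 mulr_ge0// exprn_ge0//; lra.
(* Since [j <= p ^+ 2], the Hardy weight times [p ^+ 2] is at least [(4 * j)^-1], a harmonic
   term. *)
have H2 : d / 4 * (x ^+ 2 / j) <= d * ((p * x) ^+ 2 / (4 * j ^+ 2 - 1)).
  have -> : d / 4 * (x ^+ 2 / j) = d * (x ^+ 2 * (4 * j)^-1).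
    by field; apply/eqP; lra.
  rewrite ler_wpM2l// exprMn [p ^+ 2 * _]mulrC -[leRHS]mulrA ler_wpM2l ?sqr_ge0//.
  rewrite ler_pdivlMr// mulrC ler_pdivrMr; last lra.
  by nra.
(* The remainder of the ground state identity is of order [j^-2], so a telescoping difference
   dominates it. *)
have H3 : (p * x) ^+ 2 / (2 * j * (2 * j - 1) * (2 * j + 1)) <=
    2^-1 * j^-1 - 2^-1 * (j + 1)^-1.
  have -> : 2^-1 * j^-1 - 2^-1 * (j + 1)^-1 = (2 * j * (j + 1))^-1.
    by field; apply/andP; split; apply/eqP; lra.
  have px : (p * x) ^+ 2 <= 2 * j - 1.
    rewrite exprMn (le_trans _ pu)// ler_piMr ?sqr_ge0//.
    by rewrite expr_le1.
  rewrite ler_pdivrMr; last by rewrite !mulr_gt0.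
  apply: (le_trans px).
  have -> : (2 * j * (j + 1))^-1 * (2 * j * (2 * j - 1) * (2 * j + 1)) =
     (2 * j - 1) * ((2 * j + 1) / (j + 1)).
    by field; apply/andP; split; apply/eqP; lra.
  by rewrite ler_peMr ?(ltW jm)// ler_pdivlMr; lra.
rewrite -subr_ge0.
(* The completed square of [discrete_hardy] again: with [a = p * x] and [b] the next value, it
   reduces to a multiple of [(x - y) ^+ 2]. *)
have -> : (1 + d) * ((p * x) ^+ 2 / (4 * j ^+ 2 - 1)) +
    (p * ((2 * j + 1) / (2 * j)) * y) ^+ 2 / (2 * j + 1) +
    2 * (x - y) + (2^-1 * j^-1 - 2^-1 * (j + 1)^-1) -
  ((p * ((2 * j + 1) / (2 * j)) * y - p * x) ^+ 2 + d / 4 * (x ^+ 2 / j) +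
    (p * x) ^+ 2 / (2 * j - 1)) =
  (2 * (x - y) - p ^+ 2 * ((2 * j + 1) / (2 * j)) * (x - y) ^+ 2) +
  (d * ((p * x) ^+ 2 / (4 * j ^+ 2 - 1)) - d / 4 * (x ^+ 2 / j)) +
  (2^-1 * j^-1 - 2^-1 * (j + 1)^-1 -
    (p * x) ^+ 2 / (2 * j * (2 * j - 1) * (2 * j + 1))).
  by field; rewrite !gt_eqF//=; lra.
by apply: addr_ge0; [apply: addr_ge0|]; rewrite subr_ge0.
Qed.

(* With a shift of index: [ground_state n] is [phi_(n+1)]. *)
Definition ground_state (R : realFieldType) (n : nat) : R :=
  \prod_(k < n) ((2 * k.+1%:R + 1) / (2 * k.+1%:R)).

Lemma ground_stateS (R : realFieldType) n : ground_state R n.+1 =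
  ground_state R n * ((2 * n.+1%:R + 1) / (2 * n.+1%:R)).
Proof. exact: big_ord_recr. Qed.

(** With [j = n.+1], the squared ratio [1 + j^-1 + (2 * j)^-2] sends [j] to at least [j + 1], and
    [2 * j - 1] to at most [2 * j + 1]. *)
Lemma ground_state_sqr_bounds (R : realFieldType) n :
  n.+1%:R <= ground_state R n ^+ 2 <= 2 * n.+1%:R - 1.
Proof.
elim: n => [|n /andP[IHl IHu]].
  by rewrite /ground_state big_ord0 expr1n lexx/=; lra.
rewrite ground_stateS -[n.+2%:R]natr1.
have : 1 <= n.+1%:R :> R by rewrite ler1n.
move: (n.+1%:R) (ground_state R n) IHl IHu => j p pl pu j1.
have j0 : 0 < (2 * j) ^+ 2 by rewrite exprn_gt0//; lra.
have jp : 0 <= (2 * j + 1) ^+ 2 by rewrite sqr_ge0.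
rewrite !exprMn exprVn mulrA ler_pdivlMr// ler_pdivrMr//.
apply/andP; split.
  by apply: (le_trans _ (ler_wpM2r jp pl)); nra.
by apply: (le_trans (ler_wpM2r jp pu)); nra.
Qed.

Lemma harmonic_series_unbounded (R : realType) (A : R) :
  exists n, A <= series (@harmonic R) n.
Proof.
apply: contrapT => /forallNP hA; apply: (@dvg_harmonic R).
apply: nondecreasing_is_cvgn.
  apply/nondecreasing_seqP => n.
  by rewrite /series/= big_nat_recr//= lerDl invr_ge0.
exists A => _ [n _ <-]; rewrite leNgt; apply/negP => /ltW; exact: hA.
Qed.

Lemma near_extremal (R : realType) (d : R) : 0 < d ->
  exists n (a : nat -> R), [/\ a 0%N = 0, a n.+1 = 0 &
    \sum_(j < n.+1) (a j.+1 - a j) ^+ 2 <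
    (1 + d) * \sum_(j < n) (a j.+1 ^+ 2 / (4 * j.+1%:R ^+ 2 - 1))].
Proof.
move=> d0; pose H := series (@harmonic R).
have HS n : H n.+1 = H n + n.+1%:R^-1 by rewrite /H /series/= big_nat_recr.
have Hmono : nondecreasing_seq H.
  by apply/nondecreasing_seqP => n; rewrite HS lerDl invr_ge0.
(* The cutoff equals 1 up to [M], so [d / 4 * S N] will be at least 3, more than the total error of
   at most 5/2 in [key]. The gap of 1 from [H M] to [H N] leaves room for the descent to 0. *)
have [M HM] := @harmonic_series_unbounded R (12 / d).
have [N HN] := @harmonic_series_unbounded R (H M + 1).
rewrite -/H in HM HN.
have MN : (M <= N)%N.
  rewrite leqNgt; apply/negP => /ltnW /Hmono; rewrite leNgt => /negP; apply.
  by rewrite (lt_le_trans _ HN)// ltrDl.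
pose g j := Num.min 1 (Num.max 0 (H N - H j)).
have g01 j : 0 <= g j <= 1.
  by rewrite /g le_min ler01 le_max lexx ge_min lexx.
(* Clamping to the unit interval is monotone and 1-Lipschitz, so [g] drops by at most the increment
   of [H]. *)
have gD j : 0 <= g j - g j.+1 /\ g j - g j.+1 <= j.+1%:R^-1.
  rewrite /g HS; have : 0 <= j.+1%:R^-1 :> R by rewrite invr_ge0.
  move: (j.+1%:R^-1) (H j) (H N) => e x y e0.
  have ? : Num.min 1 0 = 0 :> R by apply/min_idPr.
  case: (ltP 0 (y - x)) => ?; case: (ltP 0 (y - (x + e))) => ?;
    case: (ltP 1 (y - x)) => ?; case: (ltP 1 (y - (x + e))) => ?; split; lra.
have gN : g N = 0 by rewrite /g subrr maxxx; apply/min_idPr.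
have gM j : (j <= M)%N -> g j = 1.
  by move=> /Hmono jM; apply/min_idPl; rewrite le_max; apply/orP; right; lra.
pose a j := if j is k.+1 then ground_state R k * g k else 0.
have a0 : a 0%N = 0 by [].
have aS k : a k.+1 = ground_state R k * g k by [].
exists N, a; split => //; first by rewrite aS gN mulr0.
pose S n := \sum_(j < n) (g j ^+ 2 / j.+1%:R).
have SS n : S n.+1 = S n + g n ^+ 2 / n.+1%:R by exact: big_ord_recr.
have Smono : nondecreasing_seq S.
  apply/nondecreasing_seqP => n; rewrite SS lerDl.
  by rewrite divr_ge0 ?sqr_ge0.
have SM : S M = H M.
  rewrite /S /H /series/= big_mkord; apply: eq_bigr => j _.
  by rewrite gM ?expr1n ?mul1r// ltnW.
(* [near_extremal_step] summed over the first [n] indices: the Hardy boundary term, the drops of [g]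
   and the differences of inverses all telescope. *)
have key n : \sum_(j < n.+1) (a j.+1 - a j) ^+ 2 + d / 4 * S n <=
    (1 + d) * (\sum_(j < n) (a j.+1 ^+ 2 / (4 * j.+1%:R ^+ 2 - 1))) +
    a n.+1 ^+ 2 / n.*2.+1%:R + 2 * (g 0%N - g n) +
    (2^-1 - 2^-1 * n.+1%:R^-1).
  elim: n => [|n IH].
    by rewrite /S !big_ord0 big_ord1 a0 subr0 invr1; lra.
  rewrite SS [\sum_(j < n.+2) _]big_ord_recr.
  rewrite [\sum_(j < n.+1) _ / (_ - _)]big_ord_recr /=.
  have /andP[pl pu] := ground_state_sqr_bounds R n.
  have [g1 g2] := gD n.
  have j1 : 1 <= n.+1%:R :> R by rewrite ler1n.
  have := near_extremal_step (ltW d0) j1 pl pu (g01 n) g1 g2.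
  move: IH; rewrite !aS ground_stateS !natr_doubleS.
  rewrite -[n.+2%:R]natr1.
  have -> : 2 * n%:R + 1 = 2 * n.+1%:R - 1 :> R.
    by rewrite -[n.+1%:R]natr1; ring.
  set A1 := \sum_(j < n.+1) _; set A2 := \sum_(j < n) _.
  set P := ground_state R n.
  move: (n.+1%:R) (S n) A1 A2 (g n.+1) (g n) (g 0%N) P => {}j s A1 A2 y x z P.
  set T1 := (_ - _) ^+ 2; set T2 := _ / (4 * _ - 1).
  set T3 := _ / (2 * _ - 1); set T4 := _ / (2 * _ + 1).
  lra.
have := key N; rewrite gN aS gN mulr0 expr0n mul0r.
have := Smono _ _ MN; rewrite SM => /(le_trans HM).
rewrite ler_pdivrMr// => hS.
have /andP[_ g0] := g01 0%N.
have : 0 <= N.+1%:R^-1 :> R by rewrite invr_ge0.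
set A1 := \sum_(j < N.+1) _; set A2 := \sum_(j < N) _.
by move: (N.+1%:R^-1) (S N) A1 A2 (g 0%N) hS g0 => e s A1 A2 z; lra.
Qed.

(** * Reduction of the inner product to finite sums over boxes *)

Lemma esum_finite_support (R : realType) (I : choiceType) (f : I -> R) s :
  uniq s -> (forall x, 0 <= f x) -> (forall x, f x != 0 -> x \in s) ->
  (\esum_(x in setT) (f x)%:E = (\sum_(x <- s) f x)%:E)%E.
Proof.
move=> us f0 fs; rewrite -sumEFin fsbig_seq// -esum_fset//; last first.
  by move=> i _; rewrite lee_fin.
rewrite [RHS]esum_mkcond; apply: eq_esum => x _.
case: ifPn => //; rewrite mem_setE => xs; congr EFin; apply/eqP.
by apply: contraNT xs; exact: fs.
Qed.

(** Both parts of [f] vanish off [s], so the two extended sums are finite and [fine] loses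
    nothing. *)
Lemma rsum_finite_support (R : realType) (I : choiceType) (f : I -> R) s :
  uniq s -> (forall x, f x != 0 -> x \in s) -> rsum f = \sum_(x <- s) f x.
Proof.
move=> us fs; rewrite /rsum funerpos funerneg /comp.
rewrite !(@esum_finite_support _ _ _ s us).
- rewrite /= -sumrB; apply: eq_bigr => x _.
  by rewrite -[in RHS](funrposBneg f).
- by move=> x; exact: funrneg_ge0.
- move=> x fx; apply: fs; apply: contra_neq fx => fx.
  by rewrite /funrneg fx oppr0 maxxx.
- by move=> x; exact: funrpos_ge0.
- move=> x fx; apply: fs; apply: contra_neq fx => fx.
  by rewrite /funrpos fx maxxx.
Qed.

Definition nsucc (j : nat) : nstar := exist _ j.+1 (ltn0Sn j).

Lemma zero_ext0 (R : realType) (v : grid_fun R) i : zero_ext v i 0 = 0.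
Proof. by rewrite /zero_ext insubF. Qed.

Lemma zero_ext_nsucc (R : realType) (v : grid_fun R) i j :
  zero_ext v i j.+1 = v i (nsucc j).
Proof. by rewrite /zero_ext insubT; congr (v i _); exact: val_inj. Qed.

Definition box (s : int) (m n : nat) : seq (int * nstar) :=
  [seq (k.+1%:Z - s, nsucc j) | k <- index_iota 0 m, j <- index_iota 0 n].

Lemma box_uniq s m n : uniq (box s m n).
Proof.
apply: allpairs_uniq; rewrite ?iota_uniq// => -[k j] [k' j'] _ _ /= [].
by move=> /addIr [->] ->.
Qed.

Lemma mem_box s m n k j : (k < m)%N -> (j < n)%N ->
  (k.+1%:Z - s, nsucc j) \in box s m n.
Proof.
by move=> km jn; apply/allpairsP; exists (k, j); rewrite !mem_index_iota.
Qed.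

Lemma sum_box (R : realType) (f : int * nstar -> R) s m n :
  \sum_(p <- box s m n) f p =
  \sum_(k < m) \sum_(j < n) f (k.+1%:Z - s, nsucc j).
Proof.
rewrite /box big_allpairs_dep big_mkord.
by apply: eq_bigr => k _; rewrite big_mkord.
Qed.

Definition supported (R : realType) (v : grid_fun R) s m n :=
  forall i j, v i j != 0 -> (i, j) \in box s m n.

Lemma compact_support_box (R : realType) (v : grid_fun R) :
  compact_support v -> exists s m n, supported v s m n.
Proof.
move=> /finite_seqP[r vr].
pose A := \max_(p <- r) `|p.1|%N; pose N := \max_(p <- r) val p.2.
(* The abscissas [k.+1 - A.+1] with [k < A.*2.+1] run from [-A] to [A]. *)
exists A.+1%:Z, A.*2.+1, N => i j vij.
have ijr : (i, j) \in r by have : [set` r]%classic (i, j) by rewrite -vr.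
have iA := @leq_bigmax_seq _ r xpredT (fun p => `|p.1|%N) _ ijr isT.
have jN := @leq_bigmax_seq _ r xpredT (fun p => val p.2) _ ijr isT.
rewrite -/A -/N /= in iA jN.
have -> : i = (absz (i + A%:Z)).+1%:Z - A.+1%:Z by lia.
have -> : j = nsucc (val j).-1.
  by apply: val_inj => /=; case: j {vij ijr jN} => -[].
apply: mem_box; first lia.
by case: j jN {vij ijr} => -[].
Qed.

Lemma zero_ext_supported (R : realType) (v : grid_fun R) s m n :
  supported v s m n -> forall i j, zero_ext v i j != 0 ->
  exists k l, [/\ (k < m)%N, (l < n)%N, i = k.+1%:Z - s & j = l.+1].
Proof.
move=> vs i [|j]; first by rewrite zero_ext0 eqxx.
rewrite zero_ext_nsucc => /vs /allpairsP[] [k l] [].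
rewrite !mem_index_iota /= => km ln [-> jl].
by exists k, l; split => //; move: jl => [->].
Qed.

Lemma hyp_coef_nsucc (R : realType) j :
  hyp_coef R (nsucc j) = (4 * j.+1%:R ^+ 2 - 1) / 4.
Proof. by rewrite /hyp_coef /=; field. Qed.

Lemma hyp_coef_gt0 (R : realType) j : 0 < hyp_coef R j.
Proof.
rewrite /hyp_coef subr_gt0 (@lt_le_trans _ _ 1)//.
  by rewrite invf_lt1// ltr1n.
by rewrite expr_ge1// ler1n; case: j.
Qed.

(** * Dirichlet form and the lower bound *)

Section Box.
Context (R : realType) (v : grid_fun R) (s : int) (m n : nat).
Context (vs : supported v s m n).
Let w k j := zero_ext v (k%:Z - s) j.

Lemma inner_h_box u : inner_h u v =
  \sum_(k < m) \sum_(j < n) ((hyp_coef R (nsucc j))^-1 *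
    (u (k.+1%:Z - s) (nsucc j) * v (k.+1%:Z - s) (nsucc j))).
Proof.
rewrite /inner_h (@rsum_finite_support _ _ _ _ (box_uniq s m n)) ?sum_box//.
by move=> [i j] /=; rewrite !mulf_eq0 !negb_or => /and3P[_ _]; exact: vs.
Qed.

Lemma inner_h_self : inner_h v v = 4 *
  \sum_(k < m) \sum_(j < n) (w k.+1 j.+1 ^+ 2 / (4 * j.+1%:R ^+ 2 - 1)).
Proof.
rewrite inner_h_box mulr_sumr; apply: eq_bigr => k _; rewrite mulr_sumr.
apply: eq_bigr => j _.
by rewrite hyp_coef_nsucc invf_div /w zero_ext_nsucc; ring.
Qed.

Lemma norm_h_sqr : norm_h v ^+ 2 = inner_h v v.
Proof.
rewrite sqr_sqrtr// inner_h_box sumr_ge0// => k _; rewrite sumr_ge0// => j _.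
by rewrite mulr_ge0 ?invr_ge0 ?(ltW (hyp_coef_gt0 _ _))// -expr2 sqr_ge0.
Qed.

Lemma dirichlet_form : - inner_h (lap1 v) v =
  \sum_(j < n) \sum_(k < m.+1) (w k.+1 j.+1 - w k j.+1) ^+ 2 +
  \sum_(k < m) \sum_(j < n.+1) (w k.+1 j.+1 - w k.+1 j) ^+ 2.
Proof.
(* The function vanishes on the four lines bordering the box, as [sum_by_parts] requires in each
   direction. *)
have w_left j : w 0 j = 0.
  apply/eqP/negPn/negP => /(zero_ext_supported vs)[k [l [_ _ + _]]].
  by move=> /addIr.
have w_right j : w m.+1 j = 0.
  apply/eqP/negPn/negP => /(zero_ext_supported vs)[k [l [km _ + _]]].
  by move=> /addIr [] mk; rewrite mk ltnn in km.
have w_top k : w k n.+1 = 0.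
  apply/eqP/negPn/negP => /(zero_ext_supported vs)[_ [l [_ ln _]]].
  by case=> nl; rewrite nl ltnn in ln.
have w_bottom k : w k 0 = 0 by exact: zero_ext0.
under [X in _ = X + _]eq_bigr => j _.
  rewrite -(@sum_by_parts _ (fun k => w k j.+1) m) ?w_left ?w_right//.
  over.
under [X in _ = _ + X]eq_bigr => k _.
  rewrite -(@sum_by_parts _ (w k.+1) n) ?w_bottom ?w_top//.
  over.
rewrite exchange_big -big_split inner_h_box -sumrN; apply: eq_bigr => k _ /=.
rewrite -big_split -sumrN; apply: eq_bigr => j _ /=.
rewrite /lap1 mulrA mulKf ?gt_eqF ?hyp_coef_gt0//= -zero_ext_nsucc.
have -> : k.+1%:Z - s + 1 = k.+2%:Z - s by lia.
have -> : k.+1%:Z - s - 1 = k%:Z - s by lia.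
by rewrite /w; ring.
Qed.

Lemma spectral_gap : 4^-1 * norm_h v ^+ 2 <= - inner_h (lap1 v) v.
Proof.
rewrite norm_h_sqr inner_h_self mulKf ?pnatr_eq0// dirichlet_form.
apply: ler_wpDl.
  by apply: sumr_ge0 => j _; apply: sumr_ge0 => k _; exact: sqr_ge0.
apply: ler_sum => k _.
apply: le_trans (@discrete_hardy _ (w k.+1) n (zero_ext0 _ _)).
by rewrite lerDl divr_ge0 ?sqr_ge0.
Qed.

Lemma supported_in_l2h : in_l2h v.
Proof.
rewrite /in_l2h (@esum_finite_support _ _ _ (box s m n)) ?ltry ?box_uniq//.
  move=> [i j]; rewrite mulr_ge0 ?invr_ge0 ?(ltW (hyp_coef_gt0 _ _))//.
  by rewrite -expr2 sqr_ge0.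
by move=> [i j] /=; rewrite !mulf_eq0 !negb_or => /and3P[_ _]; exact: vs.
Qed.

Lemma supported_compact : compact_support v.
Proof.
apply: (@sub_finite_set _ _ [set` box s m n]%classic); last exact: finite_seq.
by move=> [i j] /=; exact: vs.
Qed.

End Box.

(** * Sharpness by repeated columns *)

(** The cut at row [n] ensures finite support, as [a] is arbitrary beyond [n.+1]. *)
Definition stripe (R : realType) (a : nat -> R) (L n : nat) : grid_fun R :=
  fun i j => if (0 < i <= L%:Z) && (val j <= n)%N then a (val j) else 0.

Lemma stripe_supported (R : realType) (a : nat -> R) L n :
  supported (stripe a L n) 0 L n.
Proof.
move=> i j; rewrite /stripe; case: ifPn; last by rewrite eqxx.
move=> /andP[iL jn] _.
have -> : i = (absz i).-1.+1%:Z - 0 by lia.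
have -> : j = nsucc (val j).-1 by apply: val_inj => /=; case: j {jn} => -[].
by apply: mem_box; [lia|case: j jn => -[]].
Qed.

Lemma stripe_zero_ext (R : realType) (a : nat -> R) L n k j :
  a 0%N = 0 -> a n.+1 = 0 -> (j <= n.+1)%N ->
  zero_ext (stripe a L n) (k%:Z - 0) j = (0 < k <= L)%N%:R * a j.
Proof.
move=> a0 an jn; rewrite subr0.
case: j jn => [|j] jn; first by rewrite zero_ext0 a0 mulr0.
rewrite zero_ext_nsucc /stripe /=.
have -> : (0 < k%:Z <= L%:Z) = (0 < k <= L)%N by lia.
case: (0 < k <= L)%N => /=; last by rewrite mul0r.
rewrite mul1r; case: ifPn => //; rewrite -leqNgt => nj.
by have -> : j = n by lia.
Qed.

Lemma stripe_inner (R : realType) (a : nat -> R) L n :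
  a 0%N = 0 -> a n.+1 = 0 ->
  inner_h (stripe a L n) (stripe a L n) =
  4 * (L%:R * \sum_(j < n) (a j.+1 ^+ 2 / (4 * j.+1%:R ^+ 2 - 1))).
Proof.
move=> a0 an; rewrite (inner_h_self (@stripe_supported _ a L n)); congr (_ * _).
rewrite (eq_bigr (fun=> \sum_(j < n) (a j.+1 ^+ 2 / (4 * j.+1%:R ^+ 2 - 1)))).
  by rewrite sumr_const card_ord mulr_natl.
move=> k _; apply: eq_bigr => j _.
by rewrite stripe_zero_ext//= ?ltn_ord ?mul1r// ltnW// ltnS.
Qed.

(** Horizontal differences are nonzero only on entering and leaving the stripe, whence the factor 2
    independent of [L]. *)
Lemma stripe_dirichlet (R : realType) (a : nat -> R) L n : (0 < L)%N ->
  a 0%N = 0 -> a n.+1 = 0 ->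
  - inner_h (lap1 (stripe a L n)) (stripe a L n) =
  2 * (\sum_(j < n) a j.+1 ^+ 2) +
  L%:R * \sum_(j < n.+1) (a j.+1 - a j) ^+ 2.
Proof.
move=> L0 a0 an; rewrite (dirichlet_form (@stripe_supported _ a L n)).
congr (_ + _); last first.
  rewrite (eq_bigr (fun=> \sum_(j < n.+1) (a j.+1 - a j) ^+ 2)) => [|k _].
    by rewrite sumr_const card_ord mulr_natl.
  apply: eq_bigr => j _.
  rewrite !stripe_zero_ext//=; last by rewrite ltnW// ltnW.
  by rewrite ltn_ord !mul1r.
rewrite mulr_sumr; apply: eq_bigr => j _.
case: L L0 => // L _.
have zE k := @stripe_zero_ext R a L.+1 n k j.+1 a0 an (ltnW (ltn_ord j)).
rewrite big_ord_recl big_ord_recr /= !zE big1 => [|k _].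
  by rewrite /bump leq0n add1n !ltnn leqnn ltnSn /=; ring.
rewrite /bump leq0n add1n !zE.
have -> : (0 < k.+2 <= L.+1)%N by exact: ltn_ord.
have -> : (0 < k.+1 <= L.+1)%N by exact: (ltnW (ltn_ord k)).
by rewrite subrr expr0n.
Qed.

Lemma gap_sharp (R : realType) (C : R) : 4^-1 < C ->
  ~ (forall v : grid_fun R, in_l2h v -> compact_support v ->
       C * norm_h v ^+ 2 <= - inner_h (lap1 v) v).
Proof.
move=> C4 Cgap.
have [n [a [a0 an]]] : exists n (a : nat -> R), [/\ a 0%N = 0, a n.+1 = 0 &
    \sum_(j < n.+1) (a j.+1 - a j) ^+ 2 < (1 + (4 * C - 1)) *
      \sum_(j < n) (a j.+1 ^+ 2 / (4 * j.+1%:R ^+ 2 - 1))].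
  by apply: near_extremal; lra.
have normE L := stripe_inner L a0 an.
have gradE L (L0 : (0 < L)%N) := stripe_dirichlet L0 a0 an.
set W := \sum_(j < n) (_ / _); set E := \sum_(j < n.+1) _.
pose S := \sum_(j < n) a j.+1 ^+ 2.
move=> EW; have D0 : 0 < 4 * C * W - E by move: EW; lra.
(* This [L] makes the gain [L * (4 * C * W - E)] exceed the cost [2 * S] of the two ends,
   contradicting the assumed bound. *)
have := truncnS_gt (2 * S / (4 * C * W - E)).
set L := (Num.trunc _).+1.
have := Cgap _ (supported_in_l2h (@stripe_supported _ a L n))
  (supported_compact (@stripe_supported _ a L n)).
rewrite (norm_h_sqr (@stripe_supported _ a L n)) normE gradE// -/W -/E -/S.
rewrite ltr_pdivrMr//.
lra.
Qed.

Theorem theorem4p3 (R : realType) (h : R) (hpos : 0 < h) :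
  (forall v : grid_fun R, in_l2h v -> compact_support v ->
     4^-1 * norm_h v ^+ 2 <= - inner_h (lap1 v) v)
  /\
  (forall C : R, 4^-1 < C ->
     ~ (forall v : grid_fun R, in_l2h v -> compact_support v ->
          C * norm_h v ^+ 2 <= - inner_h (lap1 v) v)).
Proof.
split; last by move=> C; exact: gap_sharp.
by move=> v _ /compact_support_box[s [m [n vs]]]; exact: spectral_gap vs.
Qed.
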